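(* Let $m\ge 4$, $n=2^m$, and let $B(n-1)$ be the number of 1-perfect binary codes of length $n-1$. Then $$B(n-1)\ \ge\ \frac{n!}{6\left(\left(\frac n4\right)!\right)^4}\prod_{k=2,4,8,\dots,\frac n4}\left(\left(2\cdot 2^{-\frac nk}\binom{k}{k/2}^{\frac nk}\right)^{2^{\frac n{2k}-1}}-\binom{k}{k/2}^{\frac nk}\cdot 2^{-\frac n{2k}}\right)^{2^{\frac n{2k}-\log_2\frac n{2k}-1}} .$$
   Context: A 1-perfect binary code of length $N$ is a set $C\subseteq\{0,1\}^N$ such that the Hamming balls of radius 1 centred at the words of $C$ are pairwise disjoint and cover $\{0,1\}^N$. The product runs over $k=2^t$, $t=1,\dots,m-2$. *)

(* Defs.v *)
From mathcomp Require Import all_boot all_order all_algebra.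

Set Implicit Arguments.
Unset Strict Implicit.
Unset Printing Implicit Defensive.

Notation binword N := {ffun 'I_N -> bool}.

Definition hamming_dist (N : nat) (x y : binword N) : nat :=
  #|[set i | x i != y i]|.

Definition hamming_ball (N r : nat) (x : binword N) : {set binword N} :=
  [set y | hamming_dist x y <= r].

Definition perfect1_code (N : nat) (C : {set binword N}) : bool :=
  [forall x in C, forall y in C,
     (x != y) ==> [disjoint hamming_ball 1 x & hamming_ball 1 y]]
  && (\bigcup_(x in C) hamming_ball 1 x == [set: binword N]).

(* Codes are counted as sets of words, not up to equivalence. *)
Definition num_perfect1_codes (N : nat) : nat :=
  #|[set C : {set binword N} | perfect1_code C]|.

(* Main.v *)
(** Work with extended codes of length n.  Partition the coordinates into D
    blocks of size 2k and fix the block parities mu: a component is a set M of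
    such words for which every word with one wrong block parity, say in block i,
    has exactly one neighbour in M obtained by flipping a coordinate of block i.
    Halving every block by a set S and fixing the parity of the words on S leaves
    2^(D-1) parity vectors for the 2D half-blocks, and the union of arbitrary
    components for these vectors is again a component.

    A double count shows that a parity check constant on a component is either a
    union of blocks or halves every block.  If the check S of each child is unique
    up to unions of blocks, the check of the union is unique too, unless all
    children have the same check and its values are affine in the parity vector.
    There are w = (C(k,k/2)/2)^(2D) checks per child, hence
    (2w)^(2^(D-1)) - 2^D w tuples of children's checks that are not of this form,
    and distinct tuples give disjoint families of components by uniqueness.

    At the top, a component for two blocks of size n/2 halved by S is an extended
    perfect code.  Uniqueness makes the four quarters of the coordinates a function
    of the code up to their 24 permutations, and the two free parities contribute
    a factor 4. *)
Require Import Defs.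
From mathcomp Require Import all_boot all_order all_algebra.
From mathcomp Require Import zify ring.

Set Implicit Arguments.
Unset Strict Implicit.
Unset Printing Implicit Defensive.

(** * Words over a finite index type, coordinate flips and parity checks *)

Section Words.

Variable T : finType.
Implicit Types (x y : {ffun T -> bool}) (s : T -> bool).

Definition flip x (j : T) : {ffun T -> bool} := [ffun i => x i (+) (i == j)].

Definition dot s x : bool := \big[addb/false]_j (s j && x j).

Lemma flipK j : involutive (flip^~ j).
Proof. by move=> x; apply/ffunP=> i; rewrite !ffunE addbK. Qed.

Lemma dot_flip s x j : dot s (flip x j) = dot s x (+) s j.
Proof.
rewrite /dot (eq_bigr (fun i => (s i && x i) (+) (s i && (i == j)))); last first.
  by move=> i _; rewrite ffunE andb_addr.
rewrite big_split /=; congr (_ (+) _).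
rewrite (bigD1 j) //= eqxx andbT big1 ?addbF // => i /negPf->.
by rewrite andbF.
Qed.

Lemma eq_dot s s' x : s =1 s' -> dot s x = dot s' x.
Proof. by move=> e; apply: eq_bigr => j _; rewrite e. Qed.

Lemma dotD s s' x : dot (fun j => s j (+) s' j) x = dot s x (+) dot s' x.
Proof. by rewrite /dot -big_split; apply: eq_bigr => j _; rewrite andb_addl. Qed.

Lemma dot_pred1 a x : dot (pred1 a) x = x a.
Proof.
rewrite /dot (bigD1 a) //= eqxx /= big1 ?addbF // => j /negPf /= ->.
by [].
Qed.

(** Flipping the coordinate [a] changes the value of the check, so the two values are taken equally
    often. *)
Lemma card_dot s a t : s a -> #|[pred x | dot s x == t]| = 2 ^ (#|T| - 1).
Proof.
move=> sa.
have e u : #|[pred x | dot s x == ~~ u]| = #|[pred x | dot s x == u]|.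
  rewrite -(card_image (can_inj (flipK a)) [pred x | dot s x == u]).
  apply: eq_card => x; rewrite -{2}[x](flipK a) (mem_image (can_inj (flipK a))).
  by rewrite !inE dot_flip sa; case: (dot s x) u => [] [].
have T0 : 0 < #|T| by apply/card_gt0P; exists a.
have: #|[pred x | dot s x == t]| * 2 = 2 ^ #|T|.
  rewrite muln2 -addnn -[X in _ + X]e -(card_bool) -card_ffun.
  rewrite -(cardC [pred x | dot s x == t]); congr (_ + _).
  by apply: eq_card => x; rewrite !inE; case: (dot s x) t {e} => [] [].
rewrite subn1 -[in RHS](prednK T0) expnSr => /eqP.
by rewrite eqn_pmul2r // => /eqP.
Qed.

End Words.

(** * Components and the parity checks constant on them *)

Section Components.

Variables (T I : finType).
Implicit Types (b : T -> I) (mu : {ffun I -> bool}) (M : {set {ffun T -> bool}}).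
Implicit Types (S x y : {ffun T -> bool}) (tau : bool).

Definition bpar b x : {ffun I -> bool} := [ffun i => dot (fun j => b j == i) x].

(* With a single block and parity 0 this says that [M] is an extended 1-perfect code. *)
Definition component b mu M :=
  [forall x in M, bpar b x == mu] &&
  [forall i, forall y, (bpar b y == flip mu i) ==>
     (#|[pred j | (b j == i) && (flip y j \in M)]| == 1)].

Definition const_on S tau M := [forall x in M, dot S x == tau].

(* A component satisfies the check of each of its blocks, so only checks modulo
   unions of blocks matter. *)
Definition sole_check b S M :=
  [forall S' : {ffun T -> bool}, forall tau, const_on S' tau M ==>
     [exists U : {ffun I -> bool}, exists c,
        forall j, S' j == (c && S j) (+) U (b j)]].

Definition good b mu S tau : {set {set {ffun T -> bool}}} :=
  [set M | [&& component b mu M, const_on S tau M & sole_check b S M]].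

Lemma bpar_flip b x j : bpar b (flip x j) = flip (bpar b x) (b j).
Proof. by apply/ffunP=> i; rewrite !ffunE dot_flip eq_sym. Qed.

Lemma dot_bpar b (U : I -> bool) x :
  dot (fun j => U (b j)) x = dot U (bpar b x).
Proof.
rewrite {2}/dot; under eq_bigr => i _ do rewrite ffunE /dot big_distrr /=.
rewrite exchange_big /=; apply: eq_bigr => j _.
rewrite (bigD1 (b j)) //= eqxx /= big1 ?addbF //.
by move=> i; rewrite eq_sym => /negPf->; rewrite andbF.
Qed.

Lemma bpar_surj b (r : I -> T) (v : {ffun I -> bool}) :
  cancel r b -> exists y, bpar b y = v.
Proof.
move=> rK; exists [ffun j => (j == r (b j)) && v (b j)].
apply/ffunP=> i; rewrite ffunE /dot (bigD1 (r i)) //= !ffunE rK !eqxx /=.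
rewrite big1 ?addbF // => j nj; rewrite ffunE.
by case: eqP => //= bj; rewrite bj (negPf nj).
Qed.

Lemma compP b mu M : reflect
  ((forall x, x \in M -> bpar b x = mu) /\
   forall i y, bpar b y = flip mu i ->
     #|[pred j | (b j == i) && (flip y j \in M)]| = 1) (component b mu M).
Proof.
apply: (iffP andP) => [[/'forall_implyP h1 /forallP h2]|[h1 h2]]; split.
- by move=> x /h1 /eqP.
- by move=> i y e; move/forallP: (h2 i) => /(_ y); rewrite e eqxx => /eqP.
- by apply/'forall_implyP=> x /h1 ->.
- apply/forallP=> i; apply/forallP=> y; apply/implyP=> /eqP e.
  by rewrite h2.
Qed.

Lemma const_onP S tau M :
  reflect (forall x, x \in M -> dot S x = tau) (const_on S tau M).
Proof. by apply: (iffP 'forall_implyP) => h x /h => [/eqP|->]. Qed.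

Lemma sole_checkP b S M : reflect
  (forall S' tau, const_on S' tau M -> exists U : {ffun I -> bool}, exists c,
     forall j, S' j = (c && S j) (+) U (b j)) (sole_check b S M).
Proof.
apply: (iffP forallP) => [h S' tau cS'|h S'].
  move/forallP: (h S') => /(_ tau); rewrite cS' => /existsP[U /existsP[c /forallP e]].
  by exists U, c => j; apply/eqP.
apply/forallP=> tau; apply/implyP=> /h[U [c e]].
by apply/existsP; exists U; apply/existsP; exists c; apply/forallP=> j; rewrite e.
Qed.

Lemma comp_neq0 b mu M (r : I -> T) (i : I) :
  cancel r b -> component b mu M -> exists x, x \in M.
Proof.
move=> rK /compP[_ h]; have [y yE] := bpar_surj (flip mu i) rK.
have /card_gt0P[j /andP[_ jM]] : 0 < #|[pred j | (b j == i) && (flip y j \in M)]|.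
  by rewrite (h _ _ yE).
by exists (flip y j).
Qed.

(** Double count of the pairs [(y, j)] with [j] in block [i] and [flip y j] in [M]. Each [y] with
    block [i] wrong has one such [j]; conversely a word of [M] and a [j] determine [y], whose check
    value is [tau (+) S j]. *)
Lemma card_const b mu M S tau i :
  component b mu M -> const_on S tau M -> forall t,
  #|[pred y | (bpar b y == flip mu i) && (dot S y == tau (+) t)]| =
  #|[pred j | (b j == i) && (S j == t)]| * #|M|.
Proof.
move=> /compP[h1 h2] /const_onP cS t.
rewrite -[LHS]sum1_card; under eq_bigl => y do rewrite inE.
transitivity (\sum_(y | (bpar b y == flip mu i) && (dot S y == tau (+) t))
   \sum_(j | b j == i) (flip y j \in M : nat)).
  apply: eq_bigr => y /andP[/eqP yE _]; rewrite -(h2 _ _ yE) -[LHS]sum1_card.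
  under [LHS]eq_bigl => j do rewrite inE.
  by rewrite big_mkcondr; apply: eq_bigr => j _; case: (flip y j \in M).
rewrite exchange_big /= (eq_bigr (fun j => if S j == t then #|M| else 0)).
  by rewrite -big_mkcondr sum_nat_const.
move=> j /eqP bj.
rewrite (reindex_inj (can_inj (flipK j))) /=.
under eq_bigr => y _ do rewrite flipK.
transitivity (\sum_(y in M) (S j == t : nat)); last first.
  by case: eqP => _; rewrite sum_nat_const ?muln1 ?muln0.
rewrite big_mkcond [RHS]big_mkcond; apply: eq_bigr => y _.
case yM: (y \in M); last by case: ifP.
rewrite bpar_flip bj (h1 _ yM) eqxx dot_flip (cS _ yM) /=.
by case: (S j) (tau) t => [] [] [].
Qed.

(** If [S] is no union of blocks, it differs at two coordinates [a], [c] of one block. Flipping both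
    keeps all block parities and changes the value of [S], so the two classes counted in
    [card_const] have equal size for every block, and the nonzero factor [#|M|] cancels. *)
Lemma halving b mu M S tau (r : I -> T) :
  cancel r b -> component b mu M -> const_on S tau M ->
  (exists U : {ffun I -> bool}, forall j, S j = U (b j)) \/
  (forall i, #|[pred j | (b j == i) && S j]| = #|[pred j | (b j == i) && ~~ S j]|).
Proof.
move=> rK cM cS.
have [/forallP h|] := boolP [forall j, S j == S (r (b j))].
  by left; exists [ffun i => S (r i)] => j; rewrite ffunE; apply/eqP.
rewrite negb_forall => /existsP[a]; set c := r (b a) => ac; right=> i.
have [x xM] := comp_neq0 i rK cM.
have M0 : 0 < #|M| by apply/card_gt0P; exists x.
apply/eqP; rewrite -(eqn_pmul2r M0); apply/eqP.
have hc := card_const i cM cS.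
rewrite (eq_card (B := [pred j | (b j == i) && (S j == true)])); last first.
  by move=> j; rewrite !inE eqb_id.
rewrite (eq_card (A := [pred j | (b j == i) && ~~ _])
  (B := [pred j | (b j == i) && (S j == false)])); last first.
  by move=> j; rewrite !inE eqbF_neg.
rewrite -!hc.
have fI : injective (fun y => flip (flip y a) c).
  exact: (inj_comp (can_inj (flipK c)) (can_inj (flipK a))).
rewrite -(card_image fI) /=.
apply: eq_card => y.
rewrite -{1}[y](flipK c) -{1}[flip y c](flipK a) (mem_image fI) !inE.
rewrite !bpar_flip !dot_flip.
have -> : b c = b a by rewrite /c rK.
rewrite flipK; congr (_ && _).
by move: ac; case: (S a) (S c) (dot S y) (tau) => [] [] [] [].
Qed.

End Components.

(** * Counting tools: covers of bounded multiplicity and halvings of blocks *)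

Lemma leq_sum_cover (A B : finType) (P : {set A}) (F : A -> {set B})
    (G : {set B}) n :
    (forall a, a \in P -> F a \subset G) ->
    (forall x, x \in G -> #|[set a in P | x \in F a]| <= n) ->
  \sum_(a in P) #|F a| <= n * #|G|.
Proof.
move=> FG Gn; under eq_bigr => a aP.
  rewrite -sum1_card -(setIidPr (FG _ aP)) (eq_bigl (fun x => (x \in G) && (x \in F a))).
    rewrite big_mkcondr; over.
  by move=> x; rewrite inE.
rewrite exchange_big /= mulnC -sum_nat_const; apply: leq_sum => x xG.
apply: leq_trans (Gn x xG); rewrite -big_mkcondr sum1_card.
by rewrite (eq_card (B := [set a in P | x \in F a])) // => a; rewrite !inE.
Qed.

Section SplitCount.

Variables (T I : finType) (b : T -> I).
Implicit Types (S : {ffun T -> bool}).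

Definition halves (h : nat) S := [forall i, #|[pred j | (b j == i) && S j]| == h].

Lemma card_halves c h : (forall i, #|[pred j | b j == i]| = c) ->
  #|halves h| = 'C(c, h) ^ #|I|.
Proof.
move=> bc; pose g S : {ffun I -> {set T}} :=
  [ffun i => [set j | (b j == i) && S j]].
have gI : injective g.
  move=> S S' /ffunP e; apply/ffunP=> j; move/setP: (e (b j)) => /(_ j).
  by rewrite !ffunE !inE eqxx.
pose F i : {set {set T}} :=
  [set A : {set T} | (A \subset [set j | b j == i]) && (#|A| == h)].
rewrite -(card_image gI) (eq_card (B := family F)).
  rewrite card_family foldrE big_image /= (eq_bigr (fun=> 'C(c, h))).
    by rewrite prod_nat_const.
  by move=> i _; rewrite cards_draws cardsE bc.
move=> f; apply/imageP/familyP => [[S /forallP hS ->] i|fF].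
  rewrite ffunE inE cardsE hS andbT.
  by apply/subsetP=> j; rewrite !inE => /andP[].
exists [ffun j => j \in f (b j)].
  apply/forallP=> i; move: (fF i); rewrite inE => /andP[/subsetP s /eqP <-].
  apply/eqP/eq_card=> j; rewrite !inE ffunE.
  apply/andP/idP => [[/eqP->//]|jf]; split; last first.
    by move/s: (jf); rewrite inE => /eqP->.
  by move/s: jf; rewrite inE.
apply/ffunP=> i; rewrite ffunE; apply/setP=> j; rewrite inE ffunE.
move: (fF i); rewrite inE => /andP[/subsetP s _].
by apply/idP/andP => [jf|[/eqP->//]]; move/s: (jf); rewrite inE => /eqP->.
Qed.

(** Complementing inside a block of size [2 * h] preserves halving. Every halving is thus obtained
    exactly once from one that contains all representatives [r i], by choosing the blocks to
    complement. *)
Lemma card_halves_rep h (r : I -> T) : cancel r b ->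
  (forall i, #|[pred j | b j == i]| = 2 * h) ->
  #|[pred S | halves h S & [forall i, S (r i)]]| * 2 ^ #|I| =
  'C(2 * h, h) ^ #|I|.
Proof.
move=> rK bc; rewrite -(card_halves h bc) -card_bool -card_ffun.
rewrite -cardX.
pose g (p : {ffun T -> bool} * {ffun I -> bool}) : {ffun T -> bool} :=
  [ffun j => p.1 j (+) p.2 (b j)].
have gI : {in [predX [pred S | halves h S & [forall i, S (r i)]] &
             {ffun I -> bool}] &, injective g}.
  move=> [S U] [S' U'] /andP[/andP[_ /forallP /= r1] _].
  move=> /andP[/andP[_ /forallP /= r2] _] /ffunP e.
  have eU : U = U'.
    apply/ffunP=> i; move: (e (r i)); rewrite !ffunE /= r1 r2 rK.
    by case: (U i) (U' i) => [] [].
  rewrite -{}eU in e *; congr (_, _); apply/ffunP=> j; move: (e j).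
  by rewrite !ffunE /=; case: (U _) (S j) (S' j) => [] [] [].
have hC S i : halves h S -> #|[pred j | (b j == i) && ~~ S j]| = h.
  move=> /forallP/(_ i)/eqP hS; apply/eqP.
  rewrite -(eqn_add2l h) addnn -mul2n -(bc i) -{1}hS.
  rewrite -(cardID [pred j | S j] [pred j | b j == i]); apply/eqP.
  by congr (_ + _); apply: eq_card => j; rewrite !inE // andbC.
have gh S (U : {ffun I -> bool}) : halves h S -> halves h (g (S, U)).
  move=> hS; apply/forallP=> i; case Ui: (U i).
    rewrite -(hC S i hS); apply/eqP/eq_card=> j; rewrite !inE ffunE /=.
    by case: eqP => //= ->; rewrite Ui addbT.
  move/forallP: hS => /(_ i)/eqP <-; apply/eqP/eq_card=> j.
  rewrite !inE ffunE /=.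
  by case: eqP => //= ->; rewrite Ui addbF.
rewrite -(card_in_image gI); apply: eq_card => S.
apply/imageP/idP => [[[S' U] /andP[/andP[hS' _] _] ->]|hS]; first exact: gh.
exists (g (S, [ffun i => ~~ S (r i)]), [ffun i => ~~ S (r i)]).
  rewrite !inE /= gh //= andbT; apply/forallP=> i.
  by rewrite !ffunE /= rK; case: (S _).
by apply/ffunP=> j; rewrite !ffunE /= addbK.
Qed.

End SplitCount.

(** * The recursive step: gluing components of the refined partition *)

Section Step.

Variables (T I : finType) (b : T -> I) (mu : {ffun I -> bool}).
Variables (S : {ffun T -> bool}) (tau : bool) (h : nat).
Hypotheses (I0 : 0 < #|I|) (h0 : 0 < h).
Hypothesis (S1 : forall i, #|[pred j | (b j == i) && S j]| = 2 * h).
Hypothesis (S0 : forall i, #|[pred j | (b j == i) && ~~ S j]| = 2 * h).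

Definition refine (j : T) : I * bool := (b j, S j).

Lemma card_refine p : #|[pred j | refine j == p]| = 2 * h.
Proof.
case: p => i [].
  by rewrite -(S1 i); apply: eq_card => j; rewrite !inE xpair_eqE eqb_id.
by rewrite -(S0 i); apply: eq_card => j; rewrite !inE xpair_eqE eqbF_neg.
Qed.

Lemma refine_section : {r : I * bool -> T | cancel r refine}.
Proof.
have ex p : exists j, refine j == p.
  have /card_gt0P[j jp] : 0 < #|[pred j | refine j == p]|.
    by rewrite card_refine muln_gt0.
  by exists j.
by exists (fun p => xchoose (ex p)) => p; apply/eqP/(xchooseP (ex p)).
Qed.

Lemma dot_pair (U : I * bool -> bool) (v : {ffun I * bool -> bool}) :
  dot U v = \big[addb/false]_i
    ((U (i, true) && v (i, true)) (+) (U (i, false) && v (i, false))).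
Proof.
rewrite /dot (eq_bigr (fun i => \big[addb/false]_c (U (i, c) && v (i, c)))).
  by rewrite pair_bigA; apply: eq_bigr => [[]].
by move=> i _; rewrite big_bool.
Qed.

Lemma dot_refine x : dot S x = dot xpredT [ffun i => bpar refine x (i, true)].
Proof.
transitivity (dot snd (bpar refine x)); first by rewrite -dot_bpar.
rewrite dot_pair; apply: eq_bigr => i _.
by rewrite [in RHS]ffunE /= addbF.
Qed.

Lemma bpar_refine x i :
  bpar b x i = bpar refine x (i, true) (+) bpar refine x (i, false).
Proof.
rewrite !ffunE -dotD; apply: eq_dot => j; rewrite !xpair_eqE.
by case: eqP => //= _; case: (S j).
Qed.

(* [e i] is the parity prescribed on the half of block [i] inside [S]. *)
Definition child (e : {ffun I -> bool}) : {ffun I * bool -> bool} :=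
  [ffun p => if p.2 then e p.1 else mu p.1 (+) e p.1].

Lemma child_inj : injective child.
Proof.
by move=> e e' /ffunP E; apply/ffunP=> i; move: (E (i, true)); rewrite !ffunE.
Qed.

Lemma bpar_child x e : bpar refine x = child e -> bpar b x = mu.
Proof.
move=> xe; apply/ffunP=> i; rewrite bpar_refine xe !ffunE /=.
by case: (e i) (mu i) => [] [].
Qed.

Lemma dot_child x e : bpar refine x = child e -> dot S x = dot xpredT e.
Proof.
move=> xe; rewrite dot_refine xe; congr dot; apply/ffunP=> i.
by rewrite !ffunE.
Qed.

(** By [dot_child] the total parity of [e] is the value of the check [S], which has to be [tau] on
    the union. *)
Definition dir := {e : {ffun I -> bool} | dot xpredT e == tau}.

Lemma card_dir : #|{: dir}| = 2 ^ (#|I| - 1).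
Proof.
have /card_gt0P[i _] := I0.
by rewrite card_sig -(@card_dot I xpredT i tau).
Qed.

Variable r : I * bool -> T.
Hypothesis rK : cancel r refine.

Lemma block_section : exists r' : I -> T, cancel r' b.
Proof. by exists (fun i => r (i, true)) => i; have [->] := rK (i, true). Qed.

Section Glue.

Variables (c : dir -> {ffun T -> bool}) (s : dir -> bool).
Variable Phi : dir -> {set {ffun T -> bool}}.
Hypothesis cr : forall e p, c e (r p).
Hypothesis Phi_good : forall e, Phi e \in good refine (child (val e)) (c e) (s e).

Lemma Phi_comp e : component refine (child (val e)) (Phi e).
Proof. by have := Phi_good e; rewrite inE => /and3P[]. Qed.

Lemma Phi_const e : const_on (c e) (s e) (Phi e).
Proof. by have := Phi_good e; rewrite inE => /and3P[]. Qed.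

Lemma Phi_sole e : sole_check refine (c e) (Phi e).
Proof. by have := Phi_good e; rewrite inE => /and3P[]. Qed.

Lemma Phi_bpar e x : x \in Phi e -> bpar refine x = child (val e).
Proof. by have /compP[+ _] := Phi_comp e; apply. Qed.

Lemma mem_glue e x : bpar refine x = child (val e) ->
  (x \in \bigcup_e Phi e) = (x \in Phi e).
Proof.
move=> xe; apply/bigcupP/idP => [[e' _ xe']|xe']; last by exists e.
suff -> : e = e' by [].
by apply/val_inj/child_inj; rewrite -xe (Phi_bpar xe').
Qed.

Lemma glue_comp : component b mu (\bigcup_e Phi e).
Proof.
apply/compP; split=> [x /bigcupP[e _ /Phi_bpar]|i y yE]; first exact: bpar_child.
(* A neighbour satisfying the check [S] must flip a coordinate of block [i] with [S j = t]. After
   that flip the parities on the [S]-halves are [e], so only the part of direction [e] can contain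
   the neighbour. *)
pose t := dot S y (+) tau.
pose e : {ffun I -> bool} :=
  [ffun i' => bpar refine y (i', true) (+) ((i' == i) && t)].
have et : dot xpredT e == tau.
  have -> : e = if t then flip [ffun i' => bpar refine y (i', true)] i
              else [ffun i' => bpar refine y (i', true)].
    apply/ffunP=> i'; rewrite !ffunE.
    by case: (t); rewrite !ffunE ?andbT // andbF addbF.
  have -> : tau = dot S y (+) t by rewrite /t; case: (dot S y) (tau) => [] [].
  by case: (t); rewrite ?dot_flip -dot_refine // addbF.
have yt : bpar refine y = flip (child e) (i, t).
  apply/ffunP=> [[i' []]].
    rewrite [RHS]ffunE [child _ _]ffunE [e _]ffunE /= xpair_eqE.
    by case: (t); rewrite ?addbK // !andbF !addbF.
  have := bpar_refine y i'; rewrite yE [flip _ _ _]ffunE.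
  move=> yb; rewrite [RHS]ffunE [child _ _]ffunE [e _]ffunE /= xpair_eqE.
  move: yb; case: (bpar _ _ _); case: (bpar _ _ _); case: (mu i');
  by case: (i' == i); case: (t).
have /compP[_ /(_ _ _ yt) <-] := Phi_comp (exist _ e et : dir).
apply: eq_card => j; rewrite !inE xpair_eqE.
case: eqP => //= bj; case: eqP => [Sj|Sj] /=.
  by apply: mem_glue; rewrite bpar_flip yt /refine bj Sj flipK.
apply/negbTE/negP => /bigcupP[e' _ /Phi_bpar /dot_child].
rewrite dot_flip (eqP (valP e')) => yj; apply: Sj; rewrite /t -yj.
by case: (S j) (dot S y) => [] [].
Qed.

Lemma glue_const : const_on S tau (\bigcup_e Phi e).
Proof.
apply/const_onP => x /bigcupP[e _ /Phi_bpar /dot_child ->].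
exact/eqP/(valP e).
Qed.

(* A second parity check of the union restricts to a check of every part; by
   uniqueness these restrictions force all [c e] to coincide and [s] to be affine. *)
Lemma glue_sole :
  ~ (exists C sg (U : {ffun I * bool -> bool}), forall e,
       c e = C /\ s e = sg (+) dot U (child (val e))) ->
  sole_check b S (\bigcup_e Phi e).
Proof.
move=> nondeg; apply/sole_checkP => S' sg cS'.
have cS'e e : const_on S' sg (Phi e).
  apply/const_onP=> x xe; move/const_onP: cS'; apply.
  by apply/bigcupP; exists e.
(* Either [S'] is itself a union of half-blocks, or uniqueness on each part makes it [c e] up to
   such a union. *)
have [/existsP[e /existsP[U /forallP hU]]|no] :=
    boolP [exists e : dir, exists U : {ffun I * bool -> bool},
           forall j, S' j == U (refine j)].
  have [r' r'K] := block_section.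
  (* A union of half-blocks that halves every block contains exactly one half of each, so it is [S]
     up to a union of blocks. *)
  have [[V hV]|half] := halving r'K glue_comp cS'.
    by exists V, false => j; rewrite hV.
  have hN i : U (i, true) = ~~ U (i, false).
    have := half i.
    have uE t : #|[pred j | (b j == i) && (S' j == t)]| =
       (U (i, true) == t) * (2 * h) + (U (i, false) == t) * (2 * h).
      rewrite -(cardID [pred j | S j]); congr (_ + _).
        case: eqP => Ut; rewrite ?mul1n -?(S1 i).
          apply: eq_card => j; rewrite !inE (eqP (hU j)) /refine.
          by case: eqP => [->|]; case: (S j); rewrite ?andbF //= Ut eqxx.
        apply: eq_card0 => j; rewrite !inE (eqP (hU j)) /refine.
        by case: eqP => [->|]; case: (S j); rewrite ?andbF //=; case: eqP.
      case: eqP => Ut; rewrite ?mul1n -?(S0 i).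
        apply: eq_card => j; rewrite !inE (eqP (hU j)) /refine.
        by case: eqP => [->|]; case: (S j); rewrite ?andbF //= Ut eqxx.
      apply: eq_card0 => j; rewrite !inE (eqP (hU j)) /refine.
      by case: eqP => [->|]; case: (S j); rewrite ?andbF //=; case: eqP.
    rewrite (eq_card (B := [pred j | (b j == i) && (S' j == true)])); last first.
      by move=> j; rewrite !inE eqb_id.
    rewrite (eq_card (A := [pred j | (b j == i) && ~~ _])
      (B := [pred j | (b j == i) && (S' j == false)])); last first.
      by move=> j; rewrite !inE eqbF_neg.
    rewrite !uE; have : 0 < 2 * h by rewrite muln_gt0.
    by case: (U _) (U _) => [] [] //=; case: (2 * h).
  exists [ffun i => U (i, false)], true => j; rewrite (eqP (hU j)) ffunE /refine.
  by case Sj: (S j) => //=; rewrite hN.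
case: nondeg.
(* Every [c e] is true at the representatives, so the union by which it differs from [S'] is read
   off from [S'] there and is the same for all [e]. *)
pose U : {ffun I * bool -> bool} := [ffun p => ~~ S' (r p)].
exists [ffun j => S' j (+) U (refine j)], sg, U => e.
have ceE : c e = [ffun j => S' j (+) U (refine j)].
  have /sole_checkP/(_ _ _ (cS'e e))[V [[] hV]] := Phi_sole e; last first.
    case/existsP: no; exists e; apply/existsP; exists V.
    by apply/forallP=> j; rewrite hV.
  have VU p : V p = U p.
    by rewrite ffunE (hV (r p)) cr rK /= negbK.
  by apply/ffunP=> j; rewrite ffunE hV -VU /= addbK.
split=> //.
have /card_gt0P[i _] := I0.
have [x xe] := comp_neq0 (i, true) rK (Phi_comp e).
have /const_onP/(_ _ xe) <- := Phi_const e.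
rewrite ceE -(Phi_bpar xe) -dot_bpar.
have /const_onP/(_ _ xe) <- := cS'e e.
by rewrite -dotD; apply: eq_dot => j; rewrite ffunE.
Qed.

End Glue.

(** [M] determines its check up to a union of blocks; requiring the check to hold at all
    representatives removes this freedom. *)
Lemma canon_unique nu C C' sg sg' M :
  halves refine h C -> halves refine h C' ->
  (forall p, C (r p)) -> (forall p, C' (r p)) ->
  M \in good refine nu C sg -> M \in good refine nu C' sg' ->
  C = C' /\ sg = sg'.
Proof.
move=> hC hC' Cr C'r; rewrite !inE => /and3P[cM /const_onP M1 M2] /and3P[_ M1' _].
have /sole_checkP/(_ _ _ M1')[V [t hV]] := M2.
have /card_gt0P[i _] := I0.
have eC : C = C'.
  case: t hV => hV.
    apply/ffunP=> j; rewrite hV.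
    have := hV (r (refine j)); rewrite Cr C'r rK /=.
    by case: (V _) => //; rewrite addbF.
  (* A union of half-blocks true at all representatives is everything, whereas [C'] has only [h] of
     the [2 * h] coordinates of a half-block. *)
  have /forallP/(_ (i, true)) := hC'.
  rewrite (eq_card (B := [pred j | refine j == (i, true)])) ?card_refine.
    by rewrite mul2n -addnn -{3}[h]addn0 eqn_add2l; case: (h) h0.
  move=> j; rewrite !inE; case: eqP => //= _; rewrite hV /=.
  by have := C'r (refine j); rewrite hV rK.
split=> //; have [x xM] := comp_neq0 (i, true) rK cM.
by rewrite -(M1 _ xM) eC; apply/const_onP: xM.
Qed.

(* The directions all satisfy the check [dot xpredT e = tau], so an affine function
   of them can be written without the coordinate [i0]. *)
Lemma affine_normal (i0 : I) sg (U : {ffun I * bool -> bool}) :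
  exists sg' (V : {ffun I -> bool}), V i0 = false /\
    forall e : dir, sg (+) dot U (child (val e)) = sg' (+) dot V (val e).
Proof.
pose a := dot (fun i => U (i, false)) mu.
pose V i := U (i, true) (+) U (i, false).
have UV e : dot U (child e) = a (+) dot V e.
  rewrite dot_pair -[a]/(dot _ _) /dot -big_split; apply: eq_bigr => i _ /=.
  rewrite !ffunE /= /V.
  by case: (U _) (U _) (e i) (mu i) => [] [] [] [].
exists (sg (+) a (+) (V i0 && tau)), [ffun i => V i (+) V i0].
split=> [|e]; first by rewrite ffunE addbb.
rewrite UV -!addbA; congr (_ (+) (_ (+) _)).
have -> : dot [ffun i => V i (+) V i0] (val e) = dot V (val e) (+) (V i0 && tau).
  rewrite (eq_dot (s' := fun i => V i (+) (V i0 && xpredT i))); last first.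
    by move=> i; rewrite ffunE andbT.
  rewrite dotD; congr (_ (+) _); transitivity (V i0 && dot xpredT (val e)).
    by rewrite /dot big_distrr; apply: eq_bigr => i _; rewrite andbT.
  by rewrite (eqP (valP e)).
by rewrite addbCA addbb addbF.
Qed.

Lemma good_step_rep L W :
  (forall nu C sg, halves refine h C -> L <= #|good refine nu C sg|) ->
  W * 2 ^ (2 * #|I|) = 'C(2 * h, h) ^ (2 * #|I|) ->
  ((2 * W) ^ (2 ^ (#|I| - 1)) - 2 ^ #|I| * W) * L ^ (2 ^ (#|I| - 1)) <=
    #|good b mu S tau|.
Proof.
move=> hL hW.
pose canon := [set C | halves refine h C & [forall p, C (r p)]].
have canonP C : C \in canon -> halves refine h C /\ forall p, C (r p).
  by rewrite inE => /andP[hC /forallP].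
have cW : #|canon| = W.
  have := card_halves_rep rK card_refine.
  rewrite card_prod card_bool [#|I| * 2]mulnC -hW => /eqP.
  by rewrite eqn_pmul2r ?expn_gt0 // => /eqP <-; rewrite cardsE.
have /card_gt0P[i0 _] := I0.
pose tot : {set {ffun dir -> {ffun T -> bool} * bool}} :=
  [set f in ffun_on (setX canon [set: bool])].
have totP f e : f \in tot -> (f e).1 \in canon.
  rewrite inE => /ffun_onP/(_ e); rewrite inE => /andP[] //.
have ctot : #|tot| = (2 * W) ^ (2 ^ (#|I| - 1)).
  by rewrite cardsE card_ffun_on cardsX cW cardsT card_bool card_dir mulnC.
(* The degenerate tuples: a common check and values affine in the direction. With [V i0] false there
   are [W] checks, 2 constants and [2 ^ (#|I| - 1)] linear parts. *)
pose F (p : {ffun T -> bool} * bool * {ffun I -> bool}) :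
    {ffun dir -> {ffun T -> bool} * bool} :=
  [ffun e => (p.1.1, p.1.2 (+) dot p.2 (val e))].
pose D := setX (setX canon [set: bool])
  [set V : {ffun I -> bool} | dot (pred1 i0) V == false].
have cD : #|D| = 2 ^ #|I| * W.
  rewrite !cardsX cW cardsT card_bool.
  have -> : #|[set V : {ffun I -> bool} | dot (pred1 i0) V == false]| = 2 ^ (#|I| - 1).
    by rewrite -(@card_dot I (pred1 i0) i0 false) /= ?cardsE.
  by rewrite -mulnA -expnS subn1 prednK // mulnC.
pose P := tot :\: F @: D.
have cP : (2 * W) ^ (2 ^ (#|I| - 1)) - 2 ^ #|I| * W <= #|P|.
  rewrite cardsD ctot -cD leq_sub2l //.
  exact: leq_trans (subset_leq_card (subsetIr _ _)) (leq_imset_card _ _).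
pose glue (Phi : {ffun dir -> {set {ffun T -> bool}}}) := \bigcup_e Phi e.
pose fam (f : {ffun dir -> {ffun T -> bool} * bool}) :=
  family (fun e => good refine (child (val e)) (f e).1 (f e).2).
(* The parts are recovered from the union by their parities on the half-blocks. *)
have glueK f Phi : Phi \in fam f -> forall e,
    Phi e = [set x in glue Phi | bpar refine x == child (val e)].
  move=> /familyP Phif e; apply/setP=> x; rewrite inE.
  apply/idP/andP => [xe|[+ /eqP xe]]; last by rewrite (mem_glue Phif xe).
  have xE := Phi_bpar Phif xe; split; last exact/eqP.
  by rewrite (mem_glue Phif xE).
have glueI f : {in fam f &, injective glue}.
  move=> Phi Phi' Pf Pf' e; apply/ffunP=> u.
  by rewrite (glueK _ _ Pf) (glueK _ _ Pf') e.
rewrite -[X in _ <= X]mul1n.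
(* Multiplicity 1: a union determines its parts by [glueK], and each part determines its normalised
   check and value by [canon_unique]. *)
apply: leq_trans (@leq_sum_cover _ _ P (fun f => glue @: fam f) _ 1 _ _); last first.
- move=> X _; apply/card_le1_eqP => f f'.
  rewrite [in X in X -> _]inE => /andP[/setDP[fT _] /imsetP[Phi Pf XE]].
  rewrite [in X in X -> _]inE => /andP[/setDP[fT' _] /imsetP[Phi' Pf' XE']].
  apply/ffunP=> e.
  have [hC Cr] := canonP _ (totP f e fT).
  have [hC' Cr'] := canonP _ (totP f' e fT').
  have Pe : Phi e = Phi' e by rewrite (glueK _ _ Pf) (glueK _ _ Pf') -XE XE'.
  move/familyP/(_ e): Pf; move/familyP/(_ e): Pf'; rewrite -Pe => g' g.
  have [e1 e2] := canon_unique hC hC' Cr Cr' g g'.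
  by rewrite [f e]surjective_pairing [f' e]surjective_pairing e1 e2.
- move=> f /setDP[fT fD]; apply/subsetP=> _ /imsetP[Phi /familyP Pf ->].
  have cr e p : (f e).1 (r p) by have [_] := canonP _ (totP f e fT).
  rewrite inE (glue_comp Pf) (glue_const Pf) (glue_sole cr Pf) //.
  case=> C [sg [U hU]]; case/imsetP: fD.
  have [sg' [V [V0 hV]]] := affine_normal i0 sg U.
  have [e0 _] : exists e : dir, True.
    have /card_gt0P[e _] : 0 < #|{: dir}| by rewrite card_dir expn_gt0.
    by exists e.
  exists (C, sg', V).
    rewrite !inE /= dot_pred1 V0 eqxx !andbT.
    by have [<- _] := hU e0; have := totP f e0 fT; rewrite inE.
  apply/ffunP=> e; have [e1 e2] := hU e.
  by rewrite ffunE /= -hV -e2 -e1 -surjective_pairing.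
apply: leq_trans (leq_mul cP (leqnn _)) _.
rewrite -sum_nat_const; apply: leq_sum => f /setDP[fT _].
rewrite (card_in_imset (@glueI f)) card_family foldrE big_image /=.
rewrite -card_dir -prod_nat_const; apply: leq_prod => e _.
by apply: hL; have [] := canonP _ (totP f e fT).
Qed.

End Step.

Lemma good_step (T I : finType) (b : T -> I) (mu : {ffun I -> bool})
    (S : {ffun T -> bool}) (tau : bool) (h L W : nat) :
    0 < #|I| -> 0 < h ->
    (forall i, #|[pred j | (b j == i) && S j]| = 2 * h) ->
    (forall i, #|[pred j | (b j == i) && ~~ S j]| = 2 * h) ->
    (forall nu C sg, halves (refine b S) h C -> L <= #|good (refine b S) nu C sg|) ->
    W * 2 ^ (2 * #|I|) = 'C(2 * h, h) ^ (2 * #|I|) ->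
  ((2 * W) ^ (2 ^ (#|I| - 1)) - 2 ^ #|I| * W) * L ^ (2 ^ (#|I| - 1)) <=
    #|good b mu S tau|.
Proof.
move=> I0 h0 S1 S0; have [r rK] := refine_section h0 S1 S0.
exact: good_step_rep rK _ _.
Qed.

(** * The base case and the recursive lower bound *)

Lemma card_block (T I : finType) (b : T -> I) (S : T -> bool) i :
  #|[pred j | b j == i]| =
  #|[pred j | (b j == i) && S j]| + #|[pred j | (b j == i) && ~~ S j]|.
Proof.
rewrite -(cardID [pred j | S j] [pred j | b j == i]).
by congr (_ + _); apply: eq_card => j; rewrite !inE // andbC.
Qed.

(** With blocks of size two, all words having the prescribed parities form a component: the value of
    [S] decides which coordinate of the pair to flip. By [halving], any check that is no union of
    blocks splits every pair, hence agrees with [S] or its complement there. *)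
Lemma good_base (T I : finType) (b : T -> I) mu (S : {ffun T -> bool}) tau :
  (forall i, #|[pred j | (b j == i) && S j]| = 1) ->
  (forall i, #|[pred j | (b j == i) && ~~ S j]| = 1) ->
  0 < #|good b mu S tau|.
Proof.
move=> S1 S0; pose M := [set x | (bpar b x == mu) && (dot S x == tau)].
have cM : component b mu M.
  apply/compP; split=> [x|i y yE]; first by rewrite inE => /andP[/eqP].
  have -> : #|[pred j | (b j == i) && (flip y j \in M)]| =
            #|[pred j | (b j == i) && (S j == dot S y (+) tau)]|.
    apply: eq_card => j; rewrite !inE bpar_flip dot_flip yE.
    case: eqP => //= ->; rewrite flipK eqxx /=.
    by case: (S j) (dot S y) (tau) => [] [] [].
  by case: (_ (+) _); [rewrite -(S1 i)|rewrite -(S0 i)]; apply: eq_card => j;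
    rewrite !inE; case: (S j).
apply/card_gt0P; exists M; rewrite inE cM /=; apply/andP; split.
  by apply/const_onP => x; rewrite inE => /andP[_ /eqP].
have ex i : exists j, (b j == i) && S j.
  have /card_gt0P[j jp] : 0 < #|[pred j | (b j == i) && S j]| by rewrite S1.
  by exists j.
pose r i := xchoose (ex i).
have rP i : b (r i) = i /\ S (r i).
  by have /andP[/eqP] := xchooseP (ex i).
have rK : cancel r b by move=> i; have [] := rP i.
apply/sole_checkP => S' sg cS'.
have [[U hU]|half] := halving rK cM cS'.
  by exists U, false => j; rewrite hU.
have c1 i t : #|[pred j | (b j == i) && (S' j == t)]| <= 1.
  have := card_block b S i; rewrite S1 S0 (card_block b S') -half addnn.
  move=> /(@double_inj _ 1) e.
  have -> : #|[pred j | (b j == i) && (S' j == t)]| =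
       if t then #|[pred j | (b j == i) && S' j]|
            else #|[pred j | (b j == i) && ~~ S' j]|.
    by case: t; apply: eq_card => j; rewrite !inE; case: (S' j).
  by rewrite -half e; case: t.
exists [ffun i => ~~ S' (r i)], true => j; rewrite ffunE /=.
have [bj Sj] := rP (b j).
case SJ: (S j).
  suff -> : j = r (b j) by rewrite bj; case: (S' _).
  have /eq_leq/card_le1_eqP := S1 (b j).
  by apply; rewrite !inE ?bj ?eqxx ?Sj.
have /card_le1_eqP h := c1 (b j) (S' j).
case e: (S' j == S' (r (b j))); last first.
  by move: e; case: (S' j); case: (S' _).
have jr : j = r (b j) by apply: h; rewrite !inE ?bj ?eqxx //= eq_sym.
by rewrite jr Sj in SJ.
Qed.

(* The number of ways to halve each of [2 D] blocks of size [2 h]. *)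
Definition nsplit h D := 'C((2 * h).-1, h) ^ (2 * D).

(** By Pascal's rule and symmetry ['C((2 * h).-1, h)] is half of the central binomial coefficient:
    it counts halvings up to complement. *)
Lemma nsplitE h D : 0 < h -> nsplit h D * 2 ^ (2 * D) = 'C(2 * h, h) ^ (2 * D).
Proof.
case: h => // h _; rewrite -expnMn; congr (_ ^ _).
have -> : 2 * h.+1 = (h + h).+2 by rewrite mul2n doubleS addnn.
rewrite muln2 -addnn [in RHS]binS; congr (_ + _).
by rewrite -bin_sub ?ltnS ?leq_addr // subSS addnK.
Qed.

(* The factor of the product for k = 2 ^ (s + 1) and n = 2 k D. *)
Definition level s D :=
  (2 * nsplit (2 ^ s) D) ^ (2 ^ (D - 1)) - 2 ^ D * nsplit (2 ^ s) D.

(** Here [D] is the number of blocks, each with [2 ^ s] coordinates inside the check and [2 ^ s]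
    outside. *)
Fixpoint lower s D :=
  if s is s'.+1 then level s' D * lower s' (2 * D) ^ (2 ^ (D - 1)) else 1.

Lemma good_lower s (T I : finType) (b : T -> I) mu (S : {ffun T -> bool}) tau :
  0 < #|I| ->
  (forall i, #|[pred j | (b j == i) && S j]| = 2 ^ s) ->
  (forall i, #|[pred j | (b j == i) && ~~ S j]| = 2 ^ s) ->
  lower s #|I| <= #|good b mu S tau|.
Proof.
elim: s => [|s IH] in I b mu S tau *; first by move=> _; apply: good_base.
rewrite expnS => I0 S1 S0 /=; have h0 : 0 < 2 ^ s by rewrite expn_gt0.
apply: (good_step (L := lower s (2 * #|I|)) _ _ I0 h0 S1 S0); last exact: nsplitE.
move=> nu C sg /forallP hC.
have C1 p : #|[pred j | (refine b S j == p) && C j]| = 2 ^ s by apply/eqP.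
have -> : 2 * #|I| = #|{: I * bool}| by rewrite card_prod card_bool mulnC.
apply: IH => //; first by rewrite card_prod card_bool muln_gt0 I0.
move=> p; apply/eqP; rewrite -(eqn_add2l (2 ^ s)) -{1}(C1 p) -card_block.
by rewrite (card_refine S1 S0) addnn mul2n.
Qed.

(** * Extended perfect codes and their quarters *)

Definition extended (T : finType) (M : {set {ffun T -> bool}}) :=
  component (fun=> tt) [ffun=> false] M.

Lemma bpar_tt (T : finType) (x : {ffun T -> bool}) :
  bpar (fun=> tt) x = [ffun=> dot xpredT x].
Proof. by apply/ffunP=> [[]]; rewrite !ffunE. Qed.

(** Both fibres of [S1] carry the parity [t1], so words of [M] are even, and an odd word is wrong on
    exactly one fibre; its neighbours in [M] all come from flips in that fibre. *)
Lemma good_extended (T : finType) (S1 S2 : {ffun T -> bool}) t1 t2 M :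
  M \in good S1 [ffun=> t1] S2 t2 -> extended M.
Proof.
rewrite inE => /and3P[/compP[M1 M2] _ _].
have dS x : dot xpredT x = bpar S1 x true (+) bpar S1 x false.
  by rewrite !ffunE -dotD; apply: eq_dot => j; case: (S1 j).
apply/compP; split=> [x xM|[] y].
  by rewrite bpar_tt dS (M1 _ xM) !ffunE addbb.
move/ffunP/(_ tt); rewrite bpar_tt [LHS]ffunE [RHS]ffunE ffunE eqxx dS => yE.
pose i := bpar S1 y true (+) t1.
have yi : bpar S1 y = flip [ffun=> t1] i.
  apply/ffunP=> u; rewrite [RHS]ffunE ffunE /i.
  by move: yE; case: u; case: (bpar S1 y true); case: (bpar S1 y false);
     case: (t1).
rewrite -(M2 _ _ yi); apply: eq_card => j; rewrite !inE /=.
case: eqP => //= ij; apply/negbTE/negP => /M1; rewrite bpar_flip yi.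
move/ffunP/(_ i); rewrite !ffunE eqxx.
by case: eqP ij => [->|_ _]; case: (t1).
Qed.

(** For [#|T| = 4 * q] a pair encodes an ordered partition into four classes of size [q], labelled
    by the values of the two checks. *)
Definition quarters (T : finType) q : {set {ffun T -> bool} * {ffun T -> bool}} :=
  [set p | halves (fun=> tt) (2 * q) p.1 & halves p.1 q p.2].

Lemma halves_true (T : finType) c (S : {ffun T -> bool}) t :
  #|T| = 2 * c -> halves (fun=> tt) c S -> #|[pred j | S j == t]| = c.
Proof.
move=> Tc /forallP/(_ tt)/eqP S1.
have e : #|[pred j | S j]| = c by rewrite -S1; apply: eq_card.
case: t; first by rewrite -[RHS]e; apply: eq_card => j; rewrite !inE eqb_id.
apply/eqP; rewrite -(eqn_add2l c) addnn -mul2n -Tc -(cardC [pred j | S j]) e.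
by rewrite eqn_add2l; apply/eqP/eq_card=> j; rewrite !inE eqbF_neg.
Qed.

Lemma card_quarters (T : finType) q : #|T| = 4 * q ->
  #|quarters T q| = 'C(4 * q, 2 * q) * 'C(2 * q, q) ^ 2.
Proof.
move=> Tq; rewrite cardsE -sum1_card.
rewrite -(pair_big_dep (halves (fun=> tt) (2 * q))
  (fun S1 : {ffun T -> bool} => halves S1 q) (fun _ _ => 1)) /=.
have c1 : #|halves (fun _ : T => tt) (2 * q)| = 'C(4 * q, 2 * q).
  rewrite (@card_halves _ _ _ (4 * q)) ?card_unit ?expn1 //.
rewrite -c1 -sum_nat_const; apply: eq_bigr => S1 hS1.
rewrite sum1_card (@card_halves _ _ _ (2 * q)) ?card_bool // => t.
by apply: halves_true => //; rewrite Tq mulnA.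
Qed.

Lemma quarters_blocks (T : finType) q p : #|T| = 4 * q -> p \in quarters T q ->
  (forall t, #|[pred j | (p.1 j == t) && p.2 j]| = q) /\
  (forall t, #|[pred j | (p.1 j == t) && ~~ p.2 j]| = q).
Proof.
move=> Tq; rewrite inE => /andP[h1 /forallP h2].
have e t : #|[pred j | (p.1 j == t) && p.2 j]| = q by apply/eqP.
split=> // t; apply/eqP; rewrite -(eqn_add2l q) -{1}(e t) -card_block.
have T2 : #|T| = 2 * (2 * q) by rewrite Tq mulnA.
by rewrite (halves_true t T2 h1) addnn mul2n.
Qed.

Lemma dot_fiber (T : finType) (S x : {ffun T -> bool}) :
  dot S x = bpar S x true.
Proof. by rewrite ffunE; apply: eq_dot => j; rewrite eqb_id. Qed.

(* All the [(S1, S2)] yielding a given code differ by permutations of the four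
   quarters, because their span with the constant check is determined by the code. *)
Lemma card_good_quarters (T : finType) q M : 0 < q -> #|T| = 4 * q ->
  #|[set a in setX (quarters T q) [set: bool * bool] |
     M \in good a.1.1 [ffun=> a.2.1] a.1.2 a.2.2]| <= 24.
Proof.
move=> q0 Tq; set X := [set a in _ | _].
have [->|/set0Pn[[[A1 A2] [s1 s2]]]] := eqVneq X set0; first by rewrite cards0.
have sect S1 S2 : (S1, S2) \in quarters T q ->
    exists r : bool * bool -> T, cancel r (refine S1 S2).
  move=> /(quarters_blocks Tq)[/= h1 h2].
  have ex p : exists j, refine S1 S2 j == p.
    have /card_gt0P[j jp] : 0 < #|[pred j | refine S1 S2 j == p]|.
      case: p => u c; apply: leq_trans q0 _; rewrite -[X in X <= _](h1 u).
      case: c; last rewrite (h1 u) -(h2 u);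
      apply: subset_leq_card; apply/subsetP=> j; rewrite !inE /refine xpair_eqE;
      by case: (S2 j); rewrite ?andbF.
    by exists j.
  by exists (fun p => xchoose (ex p)) => p; apply/eqP/(xchooseP (ex p)).
rewrite inE => /andP[/setXP[/= QA _]]; rewrite inE => /and3P[cA _ /sole_checkP spanA].
have [r rK] := sect _ _ QA.
have r1K : cancel (fun u => r (u, true)) A1.
  by move=> u; have [] := rK (u, true).
have [x xM] := comp_neq0 true r1K cA.
(* [f] relabels the quarters of [(A1, A2)]; the two check values are then forced by the word [x] of
   [M]. *)
pose F (f : {ffun bool * bool -> bool * bool}) :
    ({ffun T -> bool} * {ffun T -> bool}) * (bool * bool) :=
  let S1 : {ffun T -> bool} := [ffun j => (f (A1 j, A2 j)).1] in
  let S2 : {ffun T -> bool} := [ffun j => (f (A1 j, A2 j)).2] in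
  ((S1, S2), (dot S1 x, dot S2 x)).
have <- : #|[set f : {ffun bool * bool -> bool * bool} | injectiveb f]| = 24.
  by rewrite card_inj_ffuns !card_prod !card_bool.
apply: leq_trans (leq_imset_card F _); apply: subset_leq_card.
apply/subsetP=> [[[S1 S2] [t1 t2]]].
rewrite inE => /andP[/setXP[/= QS _]]; rewrite inE => /and3P[/compP[M1 _] M2 _].
have M1' : const_on S1 t1 M.
  by apply/const_onP=> y /M1 yM; rewrite dot_fiber yM ffunE.
have [U1 [c1 e1]] := spanA _ _ M1'.
have [U2 [c2 e2]] := spanA _ _ M2.
pose f : {ffun bool * bool -> bool * bool} :=
  [ffun p => ((c1 && p.2) (+) U1 p.1, (c2 && p.2) (+) U2 p.1)].
have fE j : f (A1 j, A2 j) = (S1 j, S2 j) by rewrite ffunE /= -e1 -e2.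
apply/imsetP; exists f.
  (* No quarter of [(S1, S2)] is empty, so [f] is onto and hence injective. *)
  rewrite inE; apply/injectiveP; have [r' r'K] := sect _ _ QS.
  apply: (can_inj (g := fun p => (A1 (r' p), A2 (r' p)))).
  by apply: canF_sym => p; rewrite fE; apply: r'K.
have E1 : [ffun j => (f (A1 j, A2 j)).1] = S1.
  by apply/ffunP=> j; rewrite ffunE fE.
have E2 : [ffun j => (f (A1 j, A2 j)).2] = S2.
  by apply/ffunP=> j; rewrite ffunE fE.
rewrite /F E1 E2; move/const_onP/(_ _ xM): M1' => ->.
by move/const_onP/(_ _ xM): M2 => ->.
Qed.

(** Quarters together with two parities index families of at least [lower s 2] codes, and each code
    lies in at most 24 families. *)
Lemma card_extended (T : finType) s : #|T| = 4 * 2 ^ s ->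
  'C(4 * 2 ^ s, 2 * 2 ^ s) * 'C(2 * 2 ^ s, 2 ^ s) ^ 2 * 4 * lower s 2 <=
    24 * #|[set M : {set {ffun T -> bool}} | extended M]|.
Proof.
move=> Tq; rewrite -(card_quarters Tq).
apply: leq_trans (@leq_sum_cover _ _
  (setX (quarters T (2 ^ s)) [set: bool * bool])
  (fun a => good a.1.1 [ffun=> a.2.1] a.1.2 a.2.2) _ _ _ _).
- have -> : #|quarters T (2 ^ s)| * 4 = #|setX (quarters T (2 ^ s)) [set: bool * bool]|.
    by rewrite cardsX cardsT card_prod card_bool.
  rewrite -sum_nat_const; apply: leq_sum => [[[S1 S2] t]] /setXP[/= QS _].
  have [h1 h2] := quarters_blocks Tq QS.
  by rewrite -card_bool; apply: good_lower; rewrite ?card_bool.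
- by move=> a _; apply/subsetP=> M /good_extended; rewrite inE.
- by move=> M _; apply: card_good_quarters; rewrite ?expn_gt0.
Qed.

(** * From extended codes to perfect codes by puncturing *)

Section Puncture.

Variable N : nat.
Implicit Types (z : binword N) (M : {set binword N.+1}).

Definition parity_ext z : binword N.+1 :=
  [ffun i => if unlift ord0 i is Some j then z j else dot xpredT z].

Definition puncture M : {set binword N} := [set z | parity_ext z \in M].

Lemma dot_parity_ext z : dot xpredT (parity_ext z) = false.
Proof.
rewrite /dot big_ord_recl /= ffunE unlift_none.
rewrite (eq_bigr (fun i => z i)) => [|i _]; last by rewrite ffunE liftK.
exact: addbb.
Qed.

Lemma eq_parity_ext (x : binword N.+1) z :
  dot xpredT x = false -> (forall i, x (lift ord0 i) = z i) -> x = parity_ext z.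
Proof.
move=> x0 xz; apply/ffunP=> i; rewrite ffunE.
case: unliftP => [j ->|->]; first exact: xz.
move: x0; rewrite /dot big_ord_recl /= (eq_bigr (fun i => z i)) //.
by case: (x ord0) (\big[_/_]_i _) => [] [].
Qed.

Lemma puncture_inj :
  {in [set M | extended M] &, injective puncture}.
Proof.
move=> M M'; rewrite !inE => /compP[h _] /compP[h' _] /setP e; apply/setP=> x.
have par0 M0 : (forall x, x \in M0 -> bpar (fun=> tt) x = [ffun=> false]) ->
    x \in M0 -> dot xpredT x = false.
  by move=> hM /hM; rewrite bpar_tt => /ffunP/(_ tt); rewrite !ffunE.
have [x0|x1] := boolP (dot xpredT x == false); last first.
  by apply/idP/idP => /par0; [move/(_ h)|move/(_ h')]; move/eqP: x1.
have := e [ffun i => x (lift ord0 i)]; rewrite !inE.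
rewrite -(@eq_parity_ext x) //; first exact/eqP.
by move=> i; rewrite ffunE.
Qed.

(** Indexes the ball around [z] by the coordinates of the extended word; the parity coordinate
    [ord0] stands for [z] itself. *)
Definition neighbor z (j : 'I_N.+1) : binword N :=
  if unlift ord0 j is Some i then flip z i else z.

Lemma parity_ext_neighbor z j :
  parity_ext (neighbor z j) = flip (flip (parity_ext z) ord0) j.
Proof.
apply/esym/eq_parity_ext; first by rewrite !dot_flip dot_parity_ext.
move=> i; rewrite /neighbor !ffunE liftK eq_sym (negPf (neq_lift _ _)) addbF.
case: unliftP => [k ->|->]; first by rewrite ffunE (inj_eq lift_inj).
by rewrite eq_sym (negPf (neq_lift _ _)) addbF.
Qed.

Lemma hamming_dist_le1 z c :
  (hamming_dist c z <= 1) = [exists j, c == neighbor z j].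
Proof.
apply/idP/existsP => [|[j /eqP->]].
  rewrite /hamming_dist leq_eqVlt => /orP[/cards1P[i ci]|].
    exists (lift ord0 i); rewrite /neighbor liftK; apply/eqP/ffunP=> k.
    have : (k \in [set i]) = (k == i) by rewrite inE.
    rewrite -ci inE ffunE => <-.
    by case: (c k) (z k) => [] [].
  rewrite ltnS leqn0 cards_eq0 => /eqP c0; exists ord0.
  rewrite /neighbor unlift_none; apply/eqP/ffunP=> k.
  have : (k \in (set0 : {set 'I_N})) = false by rewrite inE.
  by rewrite -c0 inE => /negbFE/eqP.
rewrite /neighbor; case: unlift => [i|].
  rewrite -(cards1 i); apply/subset_leq_card/subsetP=> k; rewrite !inE ffunE.
  by case: (k == i) => //; rewrite addbF eqxx.
by apply: leq_trans (leqnSn 0); rewrite leqn0 cards_eq0; apply/eqP/setP=> k;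
  rewrite !inE eqxx.
Qed.

(** The odd word [flip (parity_ext z) ord0] has exactly one neighbour in [M], and its neighbours are
    the extensions of the words in the ball around [z]. So each [z] is within distance 1 of exactly
    one codeword, which gives both disjointness and covering. *)
Lemma puncture_perfect M : extended M -> perfect1_code (puncture M).
Proof.
move=> /compP[_ hM].
have uniq_near z : exists j, forall c, (c \in puncture M) && (hamming_dist c z <= 1)
    = (c == neighbor z j).
  have := hM tt (flip (parity_ext z) ord0).
  rewrite bpar_flip bpar_tt => /(_ _)/mem_card1[|j jP].
    by apply/ffunP=> [[]]; rewrite !ffunE dot_parity_ext.
  have jM k : (neighbor z k \in puncture M) = (k == j).
    by have := jP k; rewrite !inE parity_ext_neighbor.
  exists j => c; rewrite hamming_dist_le1; apply/andP/eqP => [[cM /existsP[k /eqP ck]]|->].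
    by move: cM; rewrite ck jM => /eqP->.
  by rewrite jM eqxx; split=> //; apply/existsP; exists j.
apply/andP; split.
  apply/'forall_implyP=> c cM; apply/'forall_implyP=> c' cM'; apply/implyP.
  apply: contraR => /pred0Pn[z /andP[]]; rewrite !inE => cz cz'.
  have [j hj] := uniq_near z.
  have := hj c; have := hj c'; rewrite cM cM' cz cz' /= => /esym/eqP-> /esym/eqP->.
  exact: eqxx.
apply/eqP/setP=> z; rewrite inE; have [j hj] := uniq_near z.
have := hj (neighbor z j); rewrite eqxx => /andP[nM nz].
by apply/bigcupP; exists (neighbor z j) => //; rewrite inE.
Qed.

Lemma card_perfect_ge :
  #|[set M : {set binword N.+1} | extended M]| <= num_perfect1_codes N.
Proof.
rewrite -(card_in_imset puncture_inj); apply/subset_leq_card/subsetP=> C.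
by move=> /imsetP[M]; rewrite inE => /puncture_perfect pM ->; rewrite inE.
Qed.

End Puncture.

(** * The closed form of the bound *)

Lemma lower_prod s d :
  lower s (2 ^ d) ^ (2 ^ (2 ^ d - d - 1)) =
  \prod_(i < s) level i (2 ^ (d + (s - i.+1))) ^
    (2 ^ (2 ^ (d + (s - i.+1)) - (d + (s - i.+1)) - 1)).
Proof.
elim: s d => [|s IH] d; first by rewrite big_ord0 exp1n.
rewrite big_ord_recr /= subnn addn0 expnMn mulnC; congr (_ * _).
rewrite -expnM -expnD -expnS.
(* One unfolding of [lower] turns the outer exponent for [d] into the one for [d.+1], so the
   induction closes. *)
have -> : 2 ^ d - 1 + (2 ^ d - d - 1) = 2 ^ d.+1 - d.+1 - 1.
  by have := ltn_expl d (isT : 1 < 2); rewrite expnS; lia.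
rewrite IH; apply: eq_bigr => i _.
by rewrite subSS -(subnSK (ltn_ord i)) addnS addSn.
Qed.

Lemma card_quarter_splits q :
  'C(4 * q, 2 * q) * 'C(2 * q, q) ^ 2 * q`! ^ 4 = (4 * q)`!.
Proof.
have e1 := @bin_fact (4 * q) (2 * q); have e2 := @bin_fact (2 * q) q.
rewrite -e1; last by lia.
have -> : 4 * q - 2 * q = 2 * q by lia.
rewrite -e2; last by lia.
have -> : 2 * q - q = q by lia.
ring.
Qed.

(** Ensures that the natural subtraction in [level] is not truncated and can be cast to a field. *)
Lemma level_sub_le s D : 0 < D ->
  2 ^ D * nsplit (2 ^ s) D <= (2 * nsplit (2 ^ s) D) ^ (2 ^ (D - 1)).
Proof.
move=> D0; have W0 : 0 < nsplit (2 ^ s) D.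
  by rewrite expn_gt0 bin_gt0; have : 0 < 2 ^ s by [rewrite expn_gt0]; lia.
rewrite expnMn leq_mul ?leq_exp2l //.
  by have := ltn_expl (D - 1) (isT : 1 < 2); lia.
by rewrite -{1}[nsplit _ _]expn1 leq_pexp2l // expn_gt0.
Qed.

Import Order.TTheory GRing.Theory Num.Theory.
Local Open Scope ring_scope.

Lemma levelE (F : numFieldType) (s D : nat) : (0 < D)%N ->
  (level s D)%:R =
  (2 * 2 ^- (2 * D) * ('C(2 * 2 ^ s, 2 ^ s))%:R ^+ (2 * D)) ^+ (2 ^ (D - 1))
  - ('C(2 * 2 ^ s, 2 ^ s))%:R ^+ (2 * D) * 2 ^- D :> F.
Proof.
move=> D0; rewrite /level natrB ?level_sub_le // natrX !natrM natrX.
have -> : 'C(2 * 2 ^ s, 2 ^ s)%:R ^+ (2 * D) =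
    (nsplit (2 ^ s) D)%:R * 2 ^+ (2 * D) :> F.
  by rewrite -natrX -nsplitE ?expn_gt0 // natrM natrX.
have n0 : (2 ^+ D : F) != 0 by rewrite expf_neq0 // pnatr_eq0.
set W := (nsplit _ _)%:R; rewrite mul2n -addnn exprD.
congr (_ ^+ _ - _); first by field.
by field.
Qed.

Theorem theorem2 (m n : nat) (hm : (4 <= m)%N) (hn : n = (2 ^ m)%N) :
  ((num_perfect1_codes (n - 1))%:R : rat) >=
    (n`!)%:R / (6 * ((n %/ 4)`!)%:R ^+ 4) *
    \prod_(1 <= t < m.-1)
      let k := (2 ^ t)%N in
      ((2 * 2 ^- (n %/ k) * ('C(k, k %/ 2))%:R ^+ (n %/ k))
          ^+ (2 ^ (n %/ (2 * k) - 1))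
        - ('C(k, k %/ 2))%:R ^+ (n %/ k) * 2 ^- (n %/ (2 * k)))
        ^+ (2 ^ (n %/ (2 * k) - trunc_log 2 (n %/ (2 * k)) - 1)).
Proof.
have [s ms] : exists s, m = s.+2 by exists (m - 2)%N; lia.
have n4 : n = (4 * 2 ^ s)%N by rewrite hn ms !expnS mulnA.
set P := (X in _ * X <= _).
have -> : P = (lower s 2)%:R; last first.
  have q4 : (n %/ 4)%N = (2 ^ s)%N by rewrite n4 mulKn.
  have n1 : (n - 1).+1 = n by rewrite subn1 prednK // hn expn_gt0.
  have c4 : #|'I_(n - 1).+1| = (4 * 2 ^ s)%N by rewrite card_ord n1.
  have le1 := card_extended c4.
  have := leq_trans le1 (leq_mul (leqnn 24) (card_perfect_ge (n - 1))).
  rewrite -(ler_nat rat) q4 n4 -card_quarter_splits !natrM => le2.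
  have : (2 ^ s)`!%:R != 0 :> rat by rewrite pnatr_eq0 -lt0n fact_gt0.
  move: ((2 ^ s)`!%:R) => f f0.
  (* Multiplied by 24, the quotient by 6 becomes the factor 4 of the parity choices. *)
  rewrite -(ler_pM2l (_ : 0 < 24)) //; apply: le_trans le2.
  by rewrite le_eqVlt; apply/orP; left; apply/eqP; field.
(* For [d = 1] the outer exponent is [2 ^ 0], so the product is [lower s 2] itself. *)
rewrite /P; have := lower_prod s 1; rewrite (_ : 2 ^ (2 ^ 1 - 1 - 1) = 1)%N // !expn1 => ->.
rewrite big_add1 ms /= big_mkord natr_prod; apply: eq_bigr => i _.
rewrite natrX.
have is_ := ltn_ord i.
have -> : (2 ^ i.+1 %/ 2 = 2 ^ i)%N by rewrite expnS mulKn.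
(* With [k = 2 ^ i.+1], this quotient is the number of blocks [D] in the factor [level i D]. *)
have -> : (n %/ (2 * 2 ^ i.+1) = 2 ^ (1 + (s - i.+1)))%N.
  rewrite hn ms -expnS -expnB //; last by lia.
  by congr (2 ^ _)%N; lia.
have -> : (n %/ 2 ^ i.+1 = 2 * 2 ^ (1 + (s - i.+1)))%N.
  rewrite hn ms -expnS -expnB //; last by lia.
  by congr (2 ^ _)%N; lia.
by rewrite trunc_expnK // expnS levelE // expn_gt0.
Qed.
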